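(* Let $\iota\colon K\to N$ be an embedding of a Kummer lattice $K$ into a negative-definite even lattice $N$. Then $\iota(K)$ is orthogonal to the set $\mathrm{Roots}(N)\setminus\mathrm{Roots}(\overline{\iota(K)})$, where $\overline{\iota(K)}$ denotes the saturation of $\iota(K)$ in $N$. In particular, if $\iota$ is a saturated embedding, then $\mathrm{Roots}(\iota(K))$ is orthogonal to $\mathrm{Roots}(N)\setminus\mathrm{Roots}(\iota(K))$.
   Context: A lattice is a finite free $\mathbb Z$-module with a symmetric $\mathbb Z$-valued bilinear form; it is even if $v^2\in 2\mathbb Z$ for all $v$. An embedding of lattices is an injective homomorphism preserving the forms. The saturation of a sublattice $M\subset L$ is $L\cap(M\otimes\mathbb Q)$; an embedding is saturated if its image equals its own saturation. A root of $L$ is an element $v\in L$ with $v^2=-2$; $\mathrm{Roots}(L)$ is the set of roots, and the root sublattice is the sublattice generated by the roots. $A_n,D_n,E_n$ denote the negative-definite root lattices. Kummer lattices: for each of the pairs $(L',i)=(A_1^{\oplus 16},2^5)$, $(D_4^{\oplus 4},2^2)$, $(D_8^{\oplus 2},2)$, $(D_{16},2)$, $(E_8^{\oplus 2},1)$ there is, up to isometry, a unique even lattice whose root sublattice is isomorphic to $L'$ and has index $i$; these five lattices are called the Kummer lattices (of type $16A_1$, $4D_4$, $2D_8$, $1D_{16}$, $2E_8$ respectively). *)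

(* Defs.v *)
From HB Require Import structures.
From mathcomp Require Import all_boot all_order all_algebra.
From mathcomp Require Import classical_sets.

Set Implicit Arguments.
Unset Strict Implicit.
Unset Printing Implicit Defensive.

Import Order.TTheory GRing.Theory Num.Theory.

Local Open Scope classical_set_scope.
Local Open Scope ring_scope.

(* A [vectType] over a ring is a module equipped with a linear bijection onto
   some R^n, so [vectType int] is the type of finite free Z-modules. *)
Record lattice := Lattice {
  lat_mod :> vectType int;
  lat_form : {symmetric lat_mod}
}.

Notation "''[' u , v ]" := (lat_form _ u v) : ring_scope.
Notation "''[' u ]" := (lat_form _ u u) : ring_scope.

Definition even_lattice (L : lattice) : Prop :=
  forall v : L, (2 %| '[v])%Z.

Definition negative_definite (L : lattice) : Prop :=
  forall v : L, v != 0 -> '[v] < 0.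

Definition embedding (K L : lattice) (f : {linear K -> L}) : Prop :=
  injective f /\ isometry (lat_form L) (lat_form K) f.

Definition orthogonal_sets (L : lattice) (A B : set L) : Prop :=
  forall u v : L, A u -> B v -> '[u, v] = 0.

Definition roots_of (L : lattice) (M : set L) : set L :=
  [set v | M v /\ '[v] = -2].

Definition lin_span (R : nzRingType) (V : lmodType R) (S : set V) : set V :=
  [set v | exists (k : nat) (c : 'I_k -> R) (s : 'I_k -> V),
     (forall i, S (s i)) /\ v = \sum_i c i *: s i].

Definition root_sublattice (L : lattice) : set L :=
  lin_span (roots_of [set: L]).
Arguments root_sublattice L : clear implicits.

(* [L (x) Q] is represented by the rational row vectors, through the
   coordinates carried by the [vectType] structure of [L]; [tensorQ v] is then
   [v (x) 1], and the subspace [M (x) Q] is the Q-span of the image of [M]. *)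
Definition tensorQ (L : lattice) (v : L) : 'rV[rat]_(dim L) :=
  map_mx intr (VectorInternalTheory.v2r v).

Definition saturation (L : lattice) (M : set L) : set L :=
  [set v | lin_span (@tensorQ L @` M) (tensorQ v)].

Definition saturated_embedding (K L : lattice) (f : {linear K -> L}) : Prop :=
  embedding f /\ range f = saturation (range f).

(* [t] is a system of representatives of the cosets of [M]. *)
Definition has_index (L : lattice) (M : set L) (n : nat) : Prop :=
  exists t : 'I_n -> L, forall v : L, exists! i : 'I_n, M (v - t i).

(* The negative-definite root lattice of a simply laced Dynkin diagram whose
   nodes are 'I_n and whose edges are the pairs i, j with [e i j] or [e j i]:
   Z^n with Gram matrix the opposite of the Cartan matrix. *)
Section DynkinLattice.
Variables (n : nat) (e : rel nat).

Definition neg_cartan : 'M[int]_n :=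
  \matrix_(i, j) if i == j then -2 else (e i j || e j i)%:R.

Lemma neg_cartan_sym : neg_cartan^T = neg_cartan.
Proof. by apply/matrixP=> i j; rewrite !mxE eq_sym orbC. Qed.

Definition dynkin_form (u v : 'rV[int]_n) : int :=
  (u *m neg_cartan *m v^T) 0 0.

Lemma dynkin_formC u v : dynkin_form u v = dynkin_form v u.
Proof.
transitivity ((u *m neg_cartan *m v^T)^T 0 0); first by rewrite mxE.
by rewrite !trmx_mul trmxK neg_cartan_sym mulmxA.
Qed.

Lemma dynkin_form_linear u : scalar (dynkin_form u).
Proof.
by move=> a v w; rewrite /dynkin_form linearD linearZ mulmxDr -scalemxAr !mxE.
Qed.

Lemma dynkin_form_bilinear : bilinear_for *%R (idfun \; *%R) dynkin_form.
Proof.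
split=> u; last exact: dynkin_form_linear.
by move=> a v w; rewrite !(dynkin_formC _ u) dynkin_form_linear.
Qed.

HB.instance Definition _ :=
  bilinear_isBilinear.Build _ _ _ _ _ _ dynkin_form dynkin_form_bilinear.

Lemma dynkin_form_hermitian u v :
  dynkin_form u v = (-1) ^+ false * idfun (dynkin_form v u).
Proof. by rewrite mul1r dynkin_formC. Qed.

HB.instance Definition _ :=
  isHermitianSesquilinear.Build _ _ false idfun dynkin_form
    dynkin_form_hermitian.

Definition dynkin_lattice : lattice := Lattice dynkin_form.
End DynkinLattice.

Definition lat_A (n : nat) : lattice :=
  dynkin_lattice n (fun i j => j == i.+1).

(* The chain 0 - 1 - ... - n-2, with the last node n-1 attached to n-3. *)
Definition lat_D (n : nat) : lattice :=
  dynkin_lattice n (fun i j =>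
    ((j == i.+1) && (j < n.-1)%N) || ((j == i.+2) && (j == n.-1))).

(* The chain 0 - 1 - ... - 6, with the last node 7 attached to 2. *)
Definition lat_E8 : lattice :=
  dynkin_lattice 8 (fun i j =>
    ((j == i.+1) && (j < 7)%N) || ((i == 2) && (j == 7))).

Section DirectPower.
Variables (L : lattice) (m : nat).

Definition power_form (f g : {ffun 'I_m -> L}) : int :=
  \sum_i '[f i, g i].

Lemma power_formC f g : power_form f g = power_form g f.
Proof.
by apply: eq_bigr => i _; rewrite [LHS]hermitian_subproof mul1r.
Qed.

Lemma power_form_linear f : scalar (power_form f).
Proof.
move=> a g h; rewrite /power_form mulr_sumr -big_split /=.
by apply: eq_bigr => i _; rewrite !ffunE linearP.
Qed.

Lemma power_form_bilinear : bilinear_for *%R (idfun \; *%R) power_form.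
Proof.
split=> u; last exact: power_form_linear.
by move=> a v w; rewrite !(power_formC _ u) power_form_linear.
Qed.

HB.instance Definition _ :=
  bilinear_isBilinear.Build _ _ _ _ _ _ power_form power_form_bilinear.

Lemma power_form_hermitian f g :
  power_form f g = (-1) ^+ false * idfun (power_form g f).
Proof. by rewrite mul1r power_formC. Qed.

HB.instance Definition _ :=
  isHermitianSesquilinear.Build _ _ false idfun power_form power_form_hermitian.

Definition direct_power : lattice := Lattice power_form.
End DirectPower.

Variant kummer_type := K16A1 | K4D4 | K2D8 | K1D16 | K2E8.

Definition kummer_roots (t : kummer_type) : lattice :=
  match t with
  | K16A1 => direct_power (lat_A 1) 16
  | K4D4  => direct_power (lat_D 4) 4
  | K2D8  => direct_power (lat_D 8) 2
  | K1D16 => lat_D 16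
  | K2E8  => direct_power lat_E8 2
  end.

Definition kummer_index (t : kummer_type) : nat :=
  match t with
  | K16A1 => 2 ^ 5
  | K4D4  => 2 ^ 2
  | K2D8  => 2
  | K1D16 => 2
  | K2E8  => 1
  end.

Definition kummer_of_type (t : kummer_type) (K : lattice) : Prop :=
  [/\ even_lattice K,
      exists f : {linear kummer_roots t -> K},
        embedding f /\ range f = root_sublattice K
    & has_index (root_sublattice K) (kummer_index t)].

Definition kummer_lattice (K : lattice) : Prop :=
  exists t : kummer_type, kummer_of_type t K.

(* Main.v *)
Require Import Defs.
From mathcomp Require Import all_boot all_order all_algebra.
From mathcomp Require Import classical_sets boolp.
From mathcomp Require Import zify ring.

(** Let e_1, ..., e_16 be pairwise orthogonal roots of K.  Every x in K then
    satisfies 2x = - sum_j (x.e_j) e_j, and the parities of the x.e_j form a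
    word of length 16.  These words make up a binary code, and the theorem
    says in essence that its dual code has minimal weight at least 4.

    Indeed, let r be a root of N and c_j = r.e_j.  The form of N takes on
    2r + sum_j c_j e_j the value 2 (sum_j c_j^2) - 8.  If r is not in the
    saturation of K this vector is nonzero, so that sum_j c_j^2 <= 3.  The set
    S of the j with c_j odd has then at most 3 elements, and it is orthogonal
    mod 2 to the code because r has integral products with K.  If S is empty,
    all the c_j are even, hence zero, and r is orthogonal to K.

    So no nonempty S with at most 3 elements may be orthogonal to the code
    ([kummer_no_dual_word]).  Two facts exclude it.  First, a vector of K
    outside the root sublattice R has a word of weight at least 8
    ([heavy_word]): by evenness the weight is a multiple of 4, and a word of
    weight 0 or 4 would yield an element of R or a root.  Secondly, the
    averaging argument of the Plotkin bound ([plotkin_cosets]): if q vectors of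
    K are pairwise incongruent mod R and their words agree on S, then
    q |S| + b <= 16, where b counts the coordinates in the support of
    the words of R that vanish on S.

    - For 16A_1 there are 32 cosets, hence 2^(6 - |S|) of them that agree on S,
      and |S| 2^(6 - |S|) > 16 for |S| = 1, 2, 3.
    - For 4D_4, 2D_8 and D_16, orthogonality to the words of R forces S to be a
      pair contained in one summand, and some word of R is 1 on S.  All
      q = 4, 2, 2 cosets thus have representatives whose words vanish on S,
      while b is 12, 14, 14 : a contradiction in each case.
    - For 2E_8, S cannot even be orthogonal to the words of R, two copies of
      the self-dual Hamming code of length 8. *)

Set Implicit Arguments.
Unset Strict Implicit.
Unset Printing Implicit Defensive.

Import Order.TTheory GRing.Theory Num.Theory.

(** * Binary words *)

Section Plotkin.
Variable J : finType.
Implicit Types (D : {set {ffun J -> bool}}) (S : {set J}).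

Definition xor_closed D :=
  forall v w, v \in D -> w \in D -> [ffun j => v j (+) w j] \in D.

Definition word_support D : {set J} := [set j | [exists w in D, w j]].

(** Adding u to the words of D swaps the two values at the coordinate j. *)
Lemma xor_half D (b : bool) u j : xor_closed D -> u \in D -> u j ->
  (\sum_(w in D) (b (+) w j)).*2 = #|D|.
Proof.
move=> cD uD uj; pose t (w : {ffun J -> bool}) := [ffun i => w i (+) u i].
have tK : involutive t by move=> w; apply/ffunP=> i; rewrite !ffunE addbK.
have tD w : (t w \in D) = (w \in D).
  by apply/idP/idP=> wD; [rewrite -[w]tK|]; apply: cD.
rewrite -addnn {1}(reindex_inj (inv_inj tK)) /= (eq_bigl _ _ tD).
rewrite -big_split /= -sum1_card; apply: eq_bigr => w _.
by rewrite ffunE uj; case: b; case: (w j).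
Qed.

(** With a ones and a' zeros in a column, 2aa' ordered pairs differ, and
    4aa' <= (a + a')^2. *)
Lemma sum_addb (I : finType) (A : {set I}) (x : I -> bool) :
  (\sum_(k in A) \sum_(l in A) (x k (+) x l)).*2 <= #|A| ^ 2.
Proof.
set a := \sum_(l in A) x l; set a' := \sum_(l in A) ~~ x l.
have aa' : a + a' = #|A|.
  by rewrite -big_split -sum1_card; apply: eq_bigr => l _ /=; case: (x l).
have -> : \sum_(k in A) \sum_(l in A) (x k (+) x l) = (a * a').*2.
  rewrite -addnn {2}[a * a']mulnC !big_distrl -big_split /=.
  by apply: eq_bigr => k _; case: (x k); rewrite /= ?mul1n ?addn0.
by rewrite -aa' -!mul2n mulnA; apply: nat_AGM2.
Qed.

(** Double counting of the weights of the words x_k + x_l + w, for k <> l in A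
    and w in D.  Each coordinate in the support of D is odd in exactly half of
    them, those of S in none, and any other one in at most |A|^2 |D| / 2 of
    them.  If the conclusion failed, the average weight would thus be smaller
    than d = |J| / 2, a lower bound for all of them. *)
Lemma plotkin_cosets (I : finType) d D (A : {set I}) (x : I -> J -> bool) S :
    #|J| = d.*2 -> xor_closed D -> 0 < #|D| -> 0 < #|A| ->
    (forall w j, w \in D -> j \in S -> ~~ w j) ->
    {in A &, forall k l, {in S, x k =1 x l}} ->
    {in A &, forall k l, k != l -> forall w, w \in D ->
       d <= #|[set j | x k j (+) x l j (+) w j]|} ->
  #|S| * #|A| + #|word_support D| <= #|J|.
Proof.
move=> cardJ cD D0 A0 DS xS dist.
set q := #|A| in A0 *; set N := #|D| in D0.
pose T j := \sum_(k in A) \sum_(l in A | l != k) \sum_(w in D)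
  (x k j (+) x l j (+) w j).
have cardA k : k \in A -> \sum_(l in A | l != k) 1 = q.-1.
  by move=> kA; rewrite /q -[in RHS]sum1_card [in RHS](bigD1 k).
have lower : q * (q.-1 * (N * d)) <= \sum_j T j.
  rewrite /T exchange_big /= /q -sum_nat_const; apply: leq_sum => k kA.
  rewrite exchange_big /= -(cardA k kA) big_distrl /=.
  apply: leq_sum => l /andP[lA lk].
  rewrite /= mul1n exchange_big /= -sum_nat_const; apply: leq_sum => w wD.
  apply: leq_trans (dist k l kA lA _ w wD) _; first by rewrite eq_sym.
  rewrite -sum1_card big_mkcond /=; apply: leq_sum => j _.
  by rewrite inE; case: ifP.
(* One inequality for the three kinds of coordinates.  The term q * N accounts
   for the pairs k = l, absent from T j, when j is in the support of D. *)
have upper j : (T j).*2 + ((j \in S) * (q ^ 2 * N) +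
    (j \in word_support D) * (q * N)) <= q ^ 2 * N.
  have [js|jNs] := boolP (j \in S).
    have -> : j \in word_support D = false.
      by rewrite inE; apply/exists_inP=> -[w wD]; apply/negP/DS.
    rewrite /T big1 ?mul1n ?mul0n ?addn0 // => k kA.
    rewrite big1 // => l /andP[lA _]; rewrite big1 // => w wD.
    by rewrite (xS k l kA lA j js) addbb (negbTE (DS w j wD js)).
  have [|jNsupp] := boolP (j \in word_support D).
    rewrite inE => /exists_inP[u uD uj].
    have -> : (T j).*2 = q * (q.-1 * N).
      rewrite -mul2n /T big_distrr /= /q -sum_nat_const.
      apply: eq_bigr => k kA; rewrite big_distrr /= -(cardA k kA) big_distrl.
      by apply: eq_bigr => l _; rewrite /= mul2n (xor_half _ cD uD uj) mul1n.
    by move: A0; clear; case: q => // q _ /=; nia.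
  have -> : T j = N * \sum_(k in A) \sum_(l in A | l != k) (x k j (+) x l j).
    rewrite /T big_distrr /=; apply: eq_bigr => k _.
    rewrite big_distrr /=; apply: eq_bigr => l _.
    rewrite -sum_nat_const; apply: eq_bigr => w wD.
    have := jNsupp; rewrite inE negb_exists_in => /forall_inP/(_ w wD)/negbTE->.
    by rewrite addbF.
  rewrite !mul0n !addn0 doubleMr mulnC leq_mul2r; apply/orP; right.
  apply: leq_trans (sum_addb A (x^~ j)); rewrite leq_double.
  apply: leq_sum => k _; rewrite big_mkcondr /=; apply: leq_sum => l _.
  by case: ifP.
have : \sum_j ((T j).*2 + ((j \in S) * (q ^ 2 * N) +
    (j \in word_support D) * (q * N))) <= \sum_(j : J) q ^ 2 * N.
  by apply: leq_sum => j _; apply: upper.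
rewrite /= !big_split /= -!big_distrl /= sum_nat_const.
have -> : \sum_j (T j).*2 = (\sum_j T j).*2.
  by rewrite -mul2n big_distrr /=; apply: eq_bigr => j _; rewrite mul2n.
have cardE (B : {set J}) : \sum_j (j \in B) = #|B|.
  by rewrite -sum1_card [RHS]big_mkcond; apply: eq_bigr => j _; case: ifP.
rewrite !cardE cardJ => main.
have qN0 : 0 < q * N by rewrite muln_gt0 A0.
rewrite -(leq_pmul2r qN0); move: A0 main lower; clear.
rewrite -!mul2n; move: #|S| #|word_support D| (\sum_j T j) => s b t.
case: q => // q _; rewrite succnK; nia.
Qed.

Lemma odd_card_setU1 (w : J -> bool) a (S : {set J}) : a \notin S ->
  odd #|[set j in a |: S | w j]| = w a (+) odd #|[set j in S | w j]|.
Proof.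
move=> aS; have [wa|wNa] := boolP (w a).
  have -> : [set j in a |: S | w j] = a |: [set j in S | w j].
    by apply/setP=> j; rewrite !inE; have [->|] := eqVneq j a.
  by rewrite cardsU1 inE (negbTE aS).
congr odd; apply: eq_card => j; rewrite !inE.
by have [->|] := eqVneq j a; rewrite //= (negbTE wNa) andbF.
Qed.

(** An even word on S is determined by its values on all but one coordinate. *)
Lemma even_word_at (w : J -> bool) (S : {set J}) a : a \in S ->
  ~~ odd #|[set j in S | w j]| -> w a = odd #|[set j in S :\ a | w j]|.
Proof.
move=> aS; have := @odd_card_setU1 w a (S :\ a).
rewrite finset.setD1K // !inE eqxx => /(_ isT) ->.
by case: (w a) (odd _) => [] [].
Qed.

Lemma even_word_pair (w : J -> bool) (S : {set J}) : #|S| = 2 ->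
  ~~ odd #|[set j in S | w j]| -> {in S &, forall a b, w a = w b}.
Proof.
move=> cS even a b aS bS; have [->//|ab] := eqVneq a b.
rewrite (even_word_at aS even).
have -> : S :\ a = [set b].
  apply/eqP; rewrite eq_sym eqEcard finset.sub1set !inE eq_sym ab bS cards1.
  by have := cardsD1 a S; rewrite aS cS add1n => -[<-].
case wb: (w b).
  rewrite (_ : [set j in [set b] | w j] = [set b]) ?cards1 //.
  by apply/setP=> j; rewrite !inE; have [->|] := eqVneq j b.
rewrite (_ : [set j in [set b] | w j] = finset.set0) ?cards0 //.
by apply/setP=> j; rewrite !inE; have [->|] := eqVneq j b.
Qed.

(** Pigeonhole, one coordinate of S at a time. *)
Lemma exists_agreeing_subfamily (I : finType) (w : I -> J -> bool) (S : {set J}) :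
  exists2 A : {set I}, (#|I| <= 2 ^ #|S| * #|A|)%N &
    {in A &, forall k l, {in S, w k =1 w l}}.
Proof.
have [n] := ubnP #|S|; elim: n S => // n IH S Sn.
have [->|[a aS]] := finset.set_0Vmem S.
  by exists [set: I]; rewrite ?cards0 ?cardsT ?mul1n // => k l _ _ j; rewrite inE.
have [|A cA agA] := IH (S :\ a); first by rewrite (cardsD1 a) aS in Sn.
rewrite (cardsD1 a) aS expnS.
have agree b :
    {in [set k in A | w k a == b] &, forall k l, {in S, w k =1 w l}}.
  move=> k l /[!inE] /andP[kA /eqP ka] /andP[lA /eqP la] j jS.
  have [->|ja] := eqVneq j a; first by rewrite ka la.
  by apply: agA => //; rewrite !inE ja.
have split : #|A| = (#|[set k in A | w k a == true]| +
                     #|[set k in A | w k a == false]|)%N.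
  rewrite -(cardsID [set k | w k a] A); congr (_ + _)%N; apply: eq_card => k.
    by rewrite !inE; case: (w k a); rewrite ?andbT ?andbF.
  by rewrite !inE andbC; case: (w k a); rewrite ?andbT ?andbF.
have [le|lt] := leqP #|[set k in A | w k a == false]|
                     #|[set k in A | w k a == true]|.
  exists [set k in A | w k a == true] => //.
  by apply: leq_trans cA _; rewrite [(2 * _)%N]mulnC -mulnA leq_mul2l; lia.
exists [set k in A | w k a == false] => //.
by apply: leq_trans cA _; rewrite [(2 * _)%N]mulnC -mulnA leq_mul2l; lia.
Qed.

End Plotkin.

Local Open Scope classical_set_scope.
Local Open Scope ring_scope.

(** * Lattices and spans *)

Lemma odd_abszD (a b : int) : odd (absz (a + b)) = odd (absz a) (+) odd (absz b).
Proof. lia. Qed.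

Lemma lat_formC (L : lattice) (x y : L) : '[x, y] = '[y, x].
Proof. by rewrite hermC expr0 mul1r. Qed.

Section Form.
Variable L : lattice.
Implicit Types x y z : L.

Lemma lat_form0l z : '[0 : L, z] = 0. Proof. exact: linear0l. Qed.
Lemma lat_formNl x z : '[- x, z] = - '[x, z]. Proof. exact: linearNl. Qed.
Lemma lat_formDl x y z : '[x + y, z] = '[x, z] + '[y, z].
Proof. exact: linearDl. Qed.
Lemma lat_formBl x y z : '[x - y, z] = '[x, z] - '[y, z].
Proof. exact: linearBl. Qed.
Lemma lat_formZl (a : int) x z : '[a *: x, z] = a * '[x, z].
Proof. exact: linearZl_LR. Qed.
Lemma lat_formMnl x z n : '[x *+ n, z] = '[x, z] *+ n.
Proof. exact: linearMnl. Qed.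
Lemma lat_form_suml (J : finType) (F : J -> L) z :
  '[\sum_j F j, z] = \sum_j '[F j, z].
Proof. exact: linear_sumlz. Qed.
End Form.

Section LinSpan.
Variables (R : nzRingType) (V : lmodType R) (S : set V).

Lemma lin_span_mem v : S v -> lin_span S v.
Proof.
by move=> Sv; exists 1%N, (fun=> 1), (fun=> v); rewrite big_ord1 scale1r.
Qed.

Lemma lin_span0 : lin_span S 0.
Proof.
by exists 0%N, (fun=> 0), (fun=> 0); split; [case | rewrite big_ord0].
Qed.

Lemma lin_spanD u v : lin_span S u -> lin_span S v -> lin_span S (u + v).
Proof.
move=> [k [c [s [Ss ->]]]] [l [d [t [St ->]]]].
exists (k + l)%N, (fun i => match split i with inl a => c a | inr b => d b end),
  (fun i => match split i with inl a => s a | inr b => t b end).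
split=> [i|]; first by case: (split i).
rewrite big_split_ord; congr (_ + _); apply: eq_bigr => i _.
  by rewrite (unsplitK (inl i)).
by rewrite (unsplitK (inr i)).
Qed.

Lemma lin_spanZ a v : lin_span S v -> lin_span S (a *: v).
Proof.
move=> [k [c [s [Ss ->]]]]; exists k, (fun i => a * c i), s; split=> //.
by rewrite scaler_sumr; apply: eq_bigr => i _; rewrite scalerA.
Qed.

Lemma lin_span_sum (J : finType) (c : J -> R) (s : J -> V) :
  (forall j, lin_span S (s j)) -> lin_span S (\sum_j c j *: s j).
Proof.
move=> Ss; apply: (big_ind (lin_span S)); [exact: lin_span0 | exact: lin_spanD|].
by move=> j _; apply/lin_spanZ/Ss.
Qed.

Lemma lin_spanB u v : lin_span S u -> lin_span S v -> lin_span S (u - v).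
Proof. by move=> Su Sv; rewrite -scaleN1r; apply/lin_spanD/lin_spanZ. Qed.
End LinSpan.

Lemma root_in_root_sublattice (L : lattice) (v : L) :
  '[v] = -2 -> root_sublattice L v.
Proof. by move=> vv; apply: lin_span_mem. Qed.

Lemma negative_definite_eq0 (L : lattice) (v : L) :
  negative_definite L -> '[v] = 0 -> v = 0.
Proof. by move=> nL v0; apply/eqP/contraT => /nL; rewrite v0. Qed.

Lemma negative_definite_torsion (L : lattice) (v : L) n :
  negative_definite L -> (0 < n)%N -> v *+ n = 0 -> v = 0.
Proof.
move=> nL n0 vn; apply: negative_definite_eq0 => //; apply/eqP.
have : '[v *+ n, v] == 0 by rewrite vn lat_form0l.
by rewrite lat_formMnl mulrn_eq0 -leqn0 leqNgt n0.
Qed.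

(** The second condition says that the e_j span over the rationals; it is
    stated without denominators, so that it makes sense in the lattice. *)
Record frame (L : lattice) (J : finType) (e : J -> L) : Prop := Frame {
  frame_orth : forall i j, '[e i, e j] = if i == j then -2 else 0;
  frame_full : forall x, x *+ 2 = - \sum_j '[x, e j] *: e j }.

Definition parity (L : lattice) (J : finType) (e : J -> L) (x : L) :
  {ffun J -> bool} := [ffun j => odd `|'[x, e j]|%N].

Section Frame.
Variables (L : lattice) (J : finType) (e : J -> L).

Lemma parityD x y j : parity e (x + y) j = parity e x j (+) parity e y j.
Proof. by rewrite !ffunE lat_formDl odd_abszD. Qed.

Lemma parityB x y j : parity e (x - y) j = parity e x j (+) parity e y j.
Proof. by rewrite !ffunE lat_formBl odd_abszD abszN. Qed.

Hypothesis fe : frame e.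

Lemma frame_form x y : '[x, y] *+ 2 = - \sum_j '[x, e j] * '[y, e j].
Proof.
rewrite -lat_formMnl (frame_full fe) lat_formNl lat_form_suml; congr (- _).
by apply: eq_bigr => j _; rewrite lat_formZl (lat_formC y).
Qed.

Lemma frame_coord (a : J -> int) i : '[\sum_j a j *: e j, e i] = - 2 * a i.
Proof.
rewrite lat_form_suml (bigD1 i) //= big1 => [|j ji].
  by rewrite lat_formZl (frame_orth fe) eqxx addr0 mulrC.
by rewrite lat_formZl (frame_orth fe) (negbTE ji); apply: mulr0.
Qed.

Hypotheses (nL : negative_definite L) (eL : even_lattice L).

(** Adding multiples of the e_j to x, one may assume that all the '[x, e_j] are
    0 or 1.  Then '[x] is minus half the weight of the word of x, so that
    the weight is divisible by 4; if it is 0 then x = 0, and if it is 4 then x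
    is a root. *)
Lemma heavy_word x :
  ~ root_sublattice L x -> (8 <= #|[set j | parity e x j]%SET|)%N.
Proof.
move=> NRx; set w := #|_|.
pose y := \sum_j ('[x, e j] %/ 2)%Z *: e j; pose x' := x + y.
have NRx' : ~ root_sublattice L x'.
  move=> Rx'; apply: NRx; rewrite -[x](addrK y); apply: lin_spanB => //.
  apply: lin_span_sum => j; apply: root_in_root_sublattice.
  by rewrite (frame_orth fe) eqxx.
have x'e j : '[x', e j] = (parity e x j)%:R.
  by rewrite lat_formDl frame_coord !ffunE; lia.
have x'w : '[x'] *+ 2 = - w%:R.
  rewrite frame_form /w -sum1_card natr_sum [in RHS]big_mkcond /=; congr (- _).
  by apply: eq_bigr => j _; rewrite x'e inE; case: (parity e x j).
have := eL x'; rewrite leqNgt => /dvdzP[k kx']; apply/negP => w8.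
have [w0|w4] : w = 0%N \/ w = 4%N by lia.
  apply: NRx'; rewrite (_ : x' = 0); first exact: lin_span0.
  by apply: (negative_definite_eq0 nL); lia.
by apply: NRx'; apply: root_in_root_sublattice; lia.
Qed.

(** [plotkin_cosets] for the words of the root sublattice that vanish on S.
    The set B stands for a part of their support. *)
Lemma dual_word_bound (I : finType) (A : {set I}) (x : I -> L) (S B : {set J}) :
    #|J| = 16%N -> (0 < #|A|)%N ->
    {in A &, forall k l, {in S, parity e (x k) =1 parity e (x l)}} ->
    {in A &, forall k l, root_sublattice L (x k - x l) -> k = l} ->
    (forall j, j \in B -> exists y, [/\ root_sublattice L y, parity e y j &
        forall i, i \in S -> ~~ parity e y i]) ->
  (#|S| * #|A| + #|B| <= 16)%N.
Proof.
move=> cardJ A0 xS xR hB.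
pose D : {set {ffun J -> bool}} := [set w | `[< exists y,
  [/\ root_sublattice L y, w = parity e y &
      forall i, i \in S -> ~~ parity e y i] >]]%SET.
have cD : xor_closed D.
  move=> v w; rewrite !inE => -[y [Ry -> yS]] [z [Rz -> zS]].
  exists (y + z); split; first exact: lin_spanD.
    by apply/ffunP=> j; rewrite parityD [LHS]ffunE.
  by move=> i iS; rewrite parityD (negbTE (yS i iS)) zS.
have /leq_trans-> // :
    (#|S| * #|A| + #|B| <= #|S| * #|A| + #|word_support D|)%N.
  rewrite leq_add2l; apply/subset_leq_card/fintype.subsetP => j jB.
  have [y [Ry yj yS]] := hB j jB; rewrite inE; apply/exists_inP.
  by exists (parity e y) => //; rewrite !inE; exists y.
rewrite -[leqRHS]cardJ.
apply: (@plotkin_cosets _ _ 8 D A (fun k => parity e (x k)) S) => //.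
- apply/card_gt0P; exists (parity e 0); rewrite !inE.
  by exists 0; split=> [||i _]; rewrite ?ffunE ?lat_form0l //; apply: lin_span0.
- by move=> w j /[!inE] -[y [_ -> yS]]; apply: yS.
move=> k l kA lA kl _ /[!inE] -[y [Ry -> _]].
have : ~ root_sublattice L (x k - x l + y).
  move=> R1; case/eqP: kl; apply: xR => //.
  by rewrite -[_ - _](addrK y); apply: lin_spanB.
move=> /heavy_word/leq_trans; apply; rewrite leq_eqVlt; apply/orP; left.
apply/eqP; apply: eq_card => j.
by rewrite !inE parityD parityB.
Qed.
End Frame.

(** * Short dual words of an overlattice *)

Definition dual_word (L : lattice) (J : finType) (e : J -> L) (S : {set J}) :=
  forall x, ~~ odd #|[set j in S | parity e x j]%SET|.

Section Overlattice.
Variables (M K : lattice) (f : {linear M -> K}) (n : nat).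
Hypotheses (fM : embedding f) (fR : range f = root_sublattice K).
Hypothesis idx : has_index (root_sublattice K) n.
Hypotheses (nK : negative_definite K) (eK : even_lattice K).

Lemma in_root_sublattice y : root_sublattice K (f y).
Proof. by rewrite -fR; exists y. Qed.

Lemma index_representatives :
  exists t : 'I_n -> K, forall k l, root_sublattice K (t k - t l) -> k = l.
Proof.
have [t ht] := idx; exists t => k l kl; have [i [_ iu]] := ht (t k).
by rewrite -(iu l kl) -(iu k) // subrr; apply: lin_span0.
Qed.

(** Two of the multiples 0, x, ..., n x lie in the same coset. *)
Lemma multiple_in_root_sublattice x :
  exists2 m, (0 < m)%N & root_sublattice K (x *+ m).
Proof.
have [t ht] := idx.
have /choice[g hg] :
    forall a : 'I_n.+1, exists i, root_sublattice K (x *+ a - t i).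
  by move=> a; have [i [hi _]] := ht (x *+ a); exists i.
have [a [b [ab gab]]] : exists a b : 'I_n.+1, (a < b)%N /\ g a = g b.
  have /injectivePn[a [b ab gab]] : ~~ injectiveb g.
    by apply/injectiveP => /leq_card; rewrite !card_ord ltnn.
  have [lt|lt|/val_inj eq] := ltngtP a b; first by exists a, b.
    by exists b, a.
  by rewrite eq eqxx in ab.
exists (b - a)%N; first by rewrite subn_gt0.
rewrite mulrnBr 1?ltnW //.
have -> : x *+ b - x *+ a = x *+ b - t (g b) - (x *+ a - t (g a)).
  by rewrite gab opprB addrA subrK.
by apply: lin_spanB; apply: hg.
Qed.

Section OverFrame.
Variables (J : finType) (e : J -> M).
Hypothesis fe : frame e.

Lemma parity_overlattice y : parity (f \o e) (f y) = parity e y.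
Proof. by apply/ffunP => j; rewrite !ffunE /= fM.2. Qed.

(** The defining identity of a frame holds on the root sublattice, hence for
    a multiple of any vector of K, and K has no torsion. *)
Lemma frame_overlattice : frame (f \o e).
Proof.
split=> [i j|x]; first by rewrite /= fM.2 (frame_orth fe).
have [m m0] := multiple_in_root_sublattice x; rewrite -fR => -[y _ fy].
apply/eqP; rewrite -addr_eq0; apply/eqP.
apply: (negative_definite_torsion (n := m)) => //.
rewrite mulrnDl mulrnAC -fy -sumrMnl -raddfMn (frame_full fe) raddfN raddf_sum /=.
apply/eqP; rewrite addrC subr_eq0; apply/eqP/eq_bigr => j _.
by rewrite scalerMnl -lat_formMnl -fy fM.2 linearZ.
Qed.

Hypothesis cardJ : #|J| = 16%N.

(** The property of the words of a root lattice that excludes short dual words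
    in an even overlattice of index q with the same roots.  The coordinates
    outside U are those in the support of the words vanishing on S; the bound
    on U contradicts [dual_word_bound] when |S| = 2. *)
Definition thin_duals q := forall S : {set J}, (0 < #|S| <= 3)%N -> dual_word e S ->
  [/\ #|S| = 2, exists y, {in S, forall j, parity e y j} &
      exists2 U : {set J}, (#|U| < q.*2)%N &
        forall j, j \notin U ->
          exists2 y, parity e y j & {in S, forall i, ~~ parity e y i}].

(** A word of K takes the same value at the two elements of S, so adding a
    vector whose word is 1 on S makes all the coset representatives vanish
    there.  This gives 2 n + (16 - #|U|) <= 16. *)
Lemma thin_no_dual_word (S : {set J}) :
  thin_duals n -> (0 < #|S| <= 3)%N -> ~ dual_word (f \o e) S.
Proof.
move=> thin cardS dualS.
have [|cS [y yS] [U cU hU]] := thin S cardS.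
  by move=> x; rewrite -parity_overlattice; apply: dualS.
have [t ht] := index_representatives.
have /card_gt0P[a aS] : (0 < #|S|)%N by rewrite cS.
pose d k := if parity (f \o e) (t k) a then f y else 0.
pose x k := t k + d k.
have Rd k : root_sublattice K (d k).
  by rewrite /d; case: ifP => _; [apply: in_root_sublattice|apply: lin_span0].
have xR k l : root_sublattice K (x k - x l) -> k = l.
  rewrite /x opprD addrACA => Rkl; apply: ht.
  rewrite -[t k - t l](addrK (d k - d l)).
  exact: lin_spanB Rkl (lin_spanB (Rd k) (Rd l)).
have xS k j : j \in S -> ~~ parity (f \o e) (x k) j.
  move=> jS; rewrite parityD (even_word_pair cS (dualS (t k)) jS aS).
  rewrite /d; case: (parity _ (t k) a); first by rewrite parity_overlattice yS.
  by rewrite !ffunE lat_form0l.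
have n0 : (0 < n)%N by move: cU; case: (n).
have cUC : (#|~: U|%SET = 16 - #|U|)%N by rewrite cardsCs finset.setCK cardJ.
suff : (2 * n + #|~: U|%SET <= 16)%N by rewrite cUC; have := max_card U; lia.
have := @dual_word_bound K J _ frame_overlattice nK eK _
  [set: 'I_n]%SET x S (~: U)%SET.
rewrite cardsT card_ord cS; apply=> // [k l _ _ j jS|k l _ _|j]; first 2 last.
- rewrite inE => /hU[z zj zS]; exists (f z).
  by rewrite parity_overlattice; split=> //; apply: in_root_sublattice.
- by rewrite (negbTE (xS k j jS)) (negbTE (xS l j jS)).
exact: xR.
Qed.

(** At least 2^(6 - |S|) of the 32 representatives have words that agree on S
    minus a point, and they agree at that point by orthogonality to S; but
    |S| 2^(6 - |S|) > 16. *)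
Lemma large_index_no_dual_word (S : {set J}) :
  (32 <= n)%N -> (0 < #|S| <= 3)%N -> ~ dual_word (f \o e) S.
Proof.
move=> n32 cardS dualS; have [t ht] := index_representatives.
have /card_gt0P[a aS] : (0 < #|S|)%N by case/andP: cardS.
pose w k := parity (f \o e) (t k).
have [A cA agA] := exists_agreeing_subfamily w (S :\ a)%SET.
rewrite card_ord in cA.
have cS : #|S| = #|S :\ a|%SET.+1 by rewrite (cardsD1 a) aS.
have A0 : (0 < #|A|)%N by case: #|A| cA => // cA; lia.
have agS : {in A &, forall k l, {in S, w k =1 w l}}.
  move=> k l kA lA j jS; have [->|ja] := eqVneq j a; last first.
    by apply: agA => //; rewrite !inE ja.
  rewrite (even_word_at aS (dualS (t k))) (even_word_at aS (dualS (t l))).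
  congr odd; apply: eq_card => i; rewrite !inE.
  case: eqVneq => //= ia; case iS: (i \in S) => //=.
  by apply: agA; rewrite // !inE ia.
have : (#|S| * #|A| + #|finset.set0 : {set J}| <= 16)%N.
  apply: (dual_word_bound frame_overlattice nK eK cardJ A0 agS) => [k l _ _|j].
    exact: ht.
  by rewrite inE.
rewrite cards0; move: cA cardS; rewrite cS.
by move: #|S :\ a|%SET => [|[|[|//]]]; lia.
Qed.

End OverFrame.
End Overlattice.

(** * Frames of direct powers *)

Section Power.
Variables (L : lattice) (m : nat) (I : finType) (e : I -> L).

Definition block (b : 'I_m) (y : L) : direct_power L m :=
  [ffun b' => if b' == b then y else 0].

Definition power_frame (p : 'I_m * I) : direct_power L m := block p.1 (e p.2).

Lemma power_frame_form (x : direct_power L m) p :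
  '[x, power_frame p] = '[(x : {ffun _}) p.1, e p.2].
Proof.
rewrite [LHS](_ : _ = \sum_b '[(x : {ffun _}) b, (power_frame p : {ffun _}) b]) //.
rewrite (bigD1 p.1) //= ffunE eqxx big1 ?addr0 // => b bp.
by rewrite ffunE (negbTE bp) lat_formC lat_form0l.
Qed.

Lemma parity_block b y p : parity power_frame (block b y) p =
  (p.1 == b) && parity e y p.2.
Proof.
rewrite !ffunE power_frame_form ffunE.
by case: eqP => //= _; rewrite lat_form0l.
Qed.

Hypothesis fe : frame e.

Lemma frame_power : frame power_frame.
Proof.
split=> [[b i] [b' j]|x].
  rewrite power_frame_form ffunE /= xpair_eqE eq_sym.
  by case: eqP => _; rewrite ?lat_form0l // (frame_orth fe).
apply/ffunP=> b; rewrite ffunMnE (frame_full fe) !ffunE; congr (- _).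
rewrite -(pair_bigA _ (fun b i => '[x, power_frame (b, i)] *: power_frame (b, i))).
rewrite /= sum_ffunE (bigD1 b) //= [X in _ + X]big1 => [|b' b'b].
  rewrite addr0 sum_ffunE; apply: eq_bigr => i _.
  by rewrite power_frame_form !ffunE eqxx.
by rewrite sum_ffunE big1 // => i _; rewrite !ffunE eq_sym (negbTE b'b) scaler0.
Qed.

(** The intersection of a dual word S with a summand is a dual word there, so
    a pair when nonempty; as 2 + 2 > 3, only one summand meets S.  All the
    coordinates of the other summands are in the support of words vanishing on
    S because of the covering hypothesis. *)
Lemma thin_power q : thin_duals e q -> (forall i, exists y, parity e y i) ->
  thin_duals power_frame q.
Proof.
move=> thin cover S /andP[S0 S3] dualS.
pose at_ (b : 'I_m) : {set I} := [set i | (b, i) \in S]%SET.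
have cardS_at b (P : pred I) :
    #|[set i in at_ b | P i]%SET| = #|[set p in S | (p.1 == b) && P p.2]%SET|.
  rewrite -(card_imset _ (_ : injective (pair b))) => [|i j []//].
  apply: eq_card => -[b' i]; rewrite !inE; apply/imsetP/and3P => /= [[j]|].
    by rewrite !inE => /andP[jS Pj] [-> ->].
  by move=> [iS /eqP bb Pi]; exists i; rewrite ?inE -bb ?iS.
have dual_at b : dual_word e (at_ b).
  move=> y; rewrite cardS_at; have := dualS (block b y).
  by congr (~~ odd _); apply: eq_card => p; rewrite !inE parity_block.
have card_at b : #|at_ b| = #|[set p in S | p.1 == b]%SET|.
  transitivity #|[set i in at_ b | predT i]%SET|.
    by apply: eq_card => i; rewrite !inE andbT.
  by rewrite cardS_at; apply: eq_card => p; rewrite !inE andbT.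
have thin_at p : p \in S -> (0 < #|at_ p.1| <= 3)%N.
  move=> pS; apply/andP; split.
    by apply/card_gt0P; exists p.2; rewrite inE -surjective_pairing.
  rewrite card_at; apply: leq_trans S3; apply/subset_leq_card.
  by apply/fintype.subsetP=> x; rewrite !inE => /andP[].
have /card_gt0P[p pS] := S0.
have [card2 [y yS] [U cU hU]] := thin _ (thin_at p pS) (dual_at p.1).
have inb x : x \in S -> x.1 = p.1.
  move=> xS; apply/eqP/contraT => xp.
  have [card2' _ _] := thin _ (thin_at x xS) (dual_at x.1).
  suff : (4 <= #|S|)%N by lia.
  have <- : (#|at_ p.1| + #|at_ x.1| = 4)%N by rewrite card2 card2'.
  rewrite !card_at -(cardsID [set z | z.1 == p.1]%SET S) leq_add //.
    by apply/subset_leq_card/fintype.subsetP=> z; rewrite !inE.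
  apply/subset_leq_card/fintype.subsetP=> z; rewrite !inE => /andP[-> /eqP->].
  by rewrite xp.
split.
- rewrite -card2 card_at; apply: eq_card => x; rewrite !inE.
  by case xS: (x \in S) => //=; rewrite inb ?eqxx.
- exists (block p.1 y) => x xS; rewrite parity_block inb // eqxx.
  by apply: yS; rewrite inE -(inb x xS) -surjective_pairing.
exists (pair p.1 @: U); first by apply: leq_ltn_trans (leq_imset_card _ _) cU.
move=> x xU; have [xp|xp] := eqVneq x.1 p.1.
  have [|z zx zS] := hU x.2.
    apply: contra xU => xU; apply/imsetP; exists x.2 => //.
    by rewrite -xp -surjective_pairing.
  exists (block p.1 z) => [|s sS]; first by rewrite parity_block xp eqxx.
  rewrite parity_block inb // eqxx; apply: zS.
  by rewrite inE -(inb s sS) -surjective_pairing.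
have [z zx] := cover x.2.
exists (block x.1 z) => [|s sS]; rewrite parity_block ?eqxx //.
by rewrite inb // eq_sym (negbTE xp).
Qed.
End Power.

(** * Dynkin lattices by computation *)

(** The codes of D_4, D_8, D_16 and E_8 are small enough to be examined by
    evaluation.  Vectors are lists of integer coordinates on the simple roots,
    words are lists of booleans. *)

Fixpoint all_bits n (P : bitseq -> bool) : bool :=
  if n is m.+1 then
    all_bits m (fun s => P (true :: s)) && all_bits m (fun s => P (false :: s))
  else P [::].

Lemma all_bitsP n P s : all_bits n P -> size s = n -> P s.
Proof.
elim: n P s => [|n IH] P [|b s] //= /andP[Pt Pf] [sn].
by case: b; [apply: (IH (P \o cons true)) | apply: (IH (P \o cons false))].
Qed.

Definition sumz n (F : nat -> int) : int := foldr +%R 0 (map F (iota 0 n)).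

Lemma sumzE n (F : nat -> int) : \sum_(i < n) F i = sumz n F.
Proof. by rewrite -(big_mkord xpredT F) /sumz foldrE big_map /index_iota subn0. Qed.

Lemma enum_filter (T : finType) (A : {set T}) :
  enum A = [seq i <- enum T | i \in A].
Proof. by rewrite [in RHS]enumT. Qed.

Section Dynkin.
Variables (n : nat) (r : rel nat).
Notation L := (dynkin_lattice n r).

Definition list_vector (u : seq int) : L := \row_(j < n) u`_j.

(** The form of the lattice, as a term that evaluates. *)
Definition list_form (u v : seq int) : int :=
  sumz n (fun j => sumz n (fun i =>
    u`_i * (if i == j then -2 else (r i j || r j i)%:R)) * v`_j).

Lemma list_formE u v : '[list_vector u, list_vector v] = list_form u v.
Proof.
rewrite [LHS]mxE /list_form -sumzE; apply: eq_bigr => j _; rewrite !mxE.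
congr (_ * _).
by rewrite -sumzE; apply: eq_bigr => i _; rewrite !mxE.
Qed.

Definition unit_list i : seq int := mkseq (fun k => (k == i)%:R) n.

Variable F : seq (seq int).

Definition list_frame (j : 'I_n) : L := list_vector (nth [::] F j).

(** It is enough to test the second condition of a frame on the basis. *)
Definition frame_check : bool :=
  all (fun i => all (fun j =>
      list_form (nth [::] F i) (nth [::] F j) == (if i == j then -2 else 0))
    (iota 0 n)) (iota 0 n) &&
  all (fun i => let c := [seq list_form (unit_list i) f | f <- F] in
      all (fun k => (i == k)%:R *+ 2 ==
        - sumz n (fun j => c`_j * (nth [::] F j)`_k))
    (iota 0 n)) (iota 0 n).

Lemma all_iota (P : pred nat) (i : 'I_n) : all P (iota 0 n) -> P i.
Proof. by move=> /allP/(_ (val i)); rewrite mem_iota /= add0n ltn_ord; apply. Qed.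

Hypothesis sizeF : size F = n.

Lemma list_frameP : frame_check -> frame list_frame.
Proof.
move=> /andP[orth full]; split=> [i j|x].
  rewrite list_formE; apply/eqP.
  by have /= := all_iota j (all_iota i orth); rewrite -val_eqE.
have full_unit i : delta_mx 0 i *+ 2 =
    - \sum_j '[delta_mx 0 i : L, list_frame j] *: list_frame j.
  have -> : (delta_mx 0 i : L) = list_vector (unit_list i).
    by apply/rowP=> k; rewrite !mxE nth_mkseq // -val_eqE.
  apply/rowP=> k; have /= /eqP := all_iota k (all_iota i full).
  rewrite mulmxnE !mxE nth_mkseq // summxE => fk.
  rewrite eq_sym in fk; rewrite fk -sumzE; congr (- _); apply: eq_bigr => j _.
  by rewrite !mxE list_formE (nth_map [::]) ?sizeF.
rewrite [x in LHS](row_sum_delta x) -sumrMnl.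
under eq_bigr => i _ do rewrite scalerMnr full_unit scalerN scaler_sumr.
rewrite sumrN exchange_big; congr (- _); apply: eq_bigr => j _.
rewrite [x in RHS](row_sum_delta x) lat_form_suml scaler_suml.
by apply: eq_bigr => i _; rewrite lat_formZl scalerA.
Qed.

Definition list_words (V : seq (seq int)) : seq bitseq :=
  [seq mkseq (fun j => odd `|list_form v (nth [::] F j)|%N) n | v <- V].

(** [thin_duals], for the words of a given list: a set S of at most 3
    coordinates is not a dual word if it meets one of them in an odd set;
    otherwise S is tested directly, U being made of the coordinates where all
    the listed words that vanish on S are 0. *)
Definition thin_check q (W : seq bitseq) : bool :=
  all_bits n (fun s => if (0 < count id s <= 3)%N then
    has (fun w => odd (count id (mask s w))) W ||
    [&& count id s == 2, has (fun w => all id (mask s w)) W &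
      (count (fun j => ~~ has (fun w => nth false w j && ~~ has id (mask s w)) W)
        (iota 0 n) < q.*2)%N] else true).

Definition cover_check (W : seq bitseq) : bool :=
  all (fun j => has (fun w => nth false w j) W) (iota 0 n).

Lemma list_wordsP V w : w \in list_words V ->
  exists y, w = [seq parity list_frame y j | j <- enum 'I_n].
Proof.
case/mapP=> v _ ->; exists (list_vector v).
rewrite /mkseq -val_enum_ord -map_comp; apply: eq_map => j.
by rewrite /= ffunE list_formE.
Qed.

Lemma nth_enum_map (g : 'I_n -> bool) (j : 'I_n) :
  nth false [seq g i | i <- enum 'I_n] j = g j.
Proof. by rewrite (nth_map j) ?nth_ord_enum // size_enum_ord. Qed.

Lemma cover_checkP V j :
  cover_check (list_words V) -> exists y, parity list_frame y j.
Proof.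
move=> /(all_iota j)/hasP[w /list_wordsP[y ->]].
by rewrite nth_enum_map; exists y.
Qed.

Lemma thin_checkP V q : thin_check q (list_words V) -> thin_duals list_frame q.
Proof.
move=> check S S03 dualS; pose s := [seq i \in S | i <- enum 'I_n].
have mask_map (g : 'I_n -> bool) :
    mask s [seq g i | i <- enum 'I_n] = [seq g i | i <- enum S].
  rewrite -map_mask /s -filter_mask; congr map.
  by rewrite [RHS]enum_filter.
have count_s : count id s = #|S|.
  by rewrite /s count_map cardE enum_filter size_filter.
have := all_bitsP check (_ : size s = n); rewrite size_map size_enum_ord.
move=> /(_ erefl); rewrite count_s S03 => /orP[/hasP[w /list_wordsP[y ->]]|].
  rewrite mask_map count_map => oddSy.
  case/negP: (dualS y); move: oddSy; congr (is_true (odd _)).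
  rewrite -size_filter cardE !enum_filter -filter_predI; congr size.
  by apply: eq_filter => j; rewrite /= inE andbC.
case/and3P=> /eqP cS /hasP[w /list_wordsP[y ->]]; rewrite mask_map all_map => yS.
move=> uncovered; split=> //.
  by exists y => j jS; move/allP: yS => /(_ j); rewrite mem_enum; apply.
pose covered j :=
  has (fun w => nth false w j && ~~ has id (mask s w)) (list_words V).
exists [set j : 'I_n | ~~ covered j]%SET.
  move: uncovered; rewrite -val_enum_ord count_map -size_filter.
  congr (is_true (_ < _)%N).
  rewrite cardE enum_filter; congr size.
  by apply: eq_filter => j; rewrite inE.
move=> j; rewrite inE negbK => /hasP[w' /list_wordsP[z ->]].
rewrite nth_enum_map mask_map has_map => /andP[zj /hasPn zS].
by exists z => // i iS; apply: zS; rewrite mem_enum.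
Qed.
End Dynkin.

(** D_n is the lattice of the vectors v of Z^n with even coordinate sum.  Its
    simple roots are the b_i - b_(i+1) and b_(n-2) + b_(n-1), for the standard
    basis b; the coordinate of v on a simple root other than the last two is a
    partial sum of the v_i. *)
Definition D_vector n (v : seq int) : seq int :=
  let s k := sumz k (fun i => v`_i) in
  mkseq (fun j => if (j < n - 2)%N then s j.+1 else
    if j == (n - 2)%N then ((s n.-1 - v`_n.-1) %/ 2)%Z else (s n %/ 2)%Z) n.

Definition two_term n (a : int) i (b : int) j : seq int :=
  mkseq (fun k => if k == i then a else if k == j then b else 0) n.

(** The roots b_(2k) - b_(2k+1) and b_(2k) + b_(2k+1). *)
Definition D_frame n : seq (seq int) :=
  flatten [seq [:: D_vector n (two_term n 1 k.*2 (-1) k.*2.+1);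
                   D_vector n (two_term n 1 k.*2 1 k.*2.+1)] | k <- iota 0 n./2].

(** The roots b_(2k) + b_(2l): the word of such a root is 1 exactly at the four
    frame vectors that involve b_(2k) or b_(2l). *)
Definition D_generators n : seq (seq int) :=
  [seq D_vector n (two_term n 1 k.*2 1 l.*2) |
     k <- iota 0 n./2, l <- iota k.+1 (n./2 - k.+1)].

(** Eight orthogonal roots.  The words of the simple roots generate the
    extended Hamming code in this frame. *)
Definition E8_frame : seq (seq int) :=
  [:: [:: 1; 0; 0; 0; 0; 0; 0; 0]; [:: 0; 0; 1; 0; 0; 0; 0; 0];
      [:: 0; 0; 0; 0; 1; 0; 0; 0]; [:: 0; 0; 0; 0; 0; 0; 1; 0];
      [:: 1; 2; 3; 2; 1; 0; 0; 2]; [:: 1; 2; 3; 2; 2; 2; 1; 2];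
      [:: 1; 2; 4; 4; 3; 2; 1; 2]; [:: 2; 4; 5; 4; 3; 2; 1; 2]].

(** * The Kummer lattices *)

Definition no_dual_word (L : lattice) (J : finType) (e : J -> L) : Prop :=
  forall S : {set J}, (0 < #|S| <= 3)%N -> ~ dual_word e S.

Lemma card_power_index m n : #|{: 'I_m * 'I_n}| = (m * n)%N.
Proof. by rewrite card_prod !card_ord. Qed.

(** The index 2^5 is large enough for 16A_1.  In the other cases [thin_duals]
    is checked on one summand, with the index of the whole root sublattice. *)
Lemma kummer_no_dual_word t (K : lattice) :
    negative_definite K -> kummer_of_type t K ->
  exists (J : finType) (e : J -> K), frame e /\ no_dual_word e.
Proof.
move=> nK [eK [f [fM fR]] idx].
have thin_case (J : finType) (e : J -> kummer_roots t) :
    frame e -> #|J| = 16%N -> thin_duals e (kummer_index t) ->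
  exists (J : finType) (e : J -> K), frame e /\ no_dual_word e.
  move=> fe cardJ thin; exists J, (f \o e); split.
    exact: (frame_overlattice fM fR idx nK fe).
  by move=> S S03; apply: (thin_no_dual_word fM fR idx nK eK fe cardJ thin S03).
have block_case m n r F V (g : {linear direct_power (dynkin_lattice n r) m -> K}) :
    embedding g -> range g = root_sublattice K -> (m * n)%N = 16%N -> size F = n ->
    frame_check n r F -> cover_check n (list_words n r F V) ->
    thin_check n (kummer_index t) (list_words n r F V) ->
  exists (J : finType) (e : J -> K), frame e /\ no_dual_word e.
  move=> gM gR mn sF fF cF tF.
  have fe := frame_power m (list_frameP sF fF).
  have thin := @thin_power _ m _ _ _ (thin_checkP tF) (fun i => cover_checkP i cF).
  exists _, (g \o power_frame (list_frame r F)); split.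
    exact: (frame_overlattice gM gR idx nK fe).
  move=> S; apply: (thin_no_dual_word gM gR idx nK eK fe _ thin).
  by rewrite card_power_index.
case: t f fM fR idx thin_case block_case => f fM fR idx thin_case block_case.
- have fF : frame_check 1 (fun i j => j == i.+1) [:: [:: 1]] by vm_compute.
  have fe := frame_power 16 (list_frameP (erefl : size [:: [:: 1]] = 1%N) fF).
  exists _, (f \o power_frame (list_frame (fun i j => j == i.+1) [:: [:: 1]])).
  split; first exact: (frame_overlattice fM fR idx nK fe).
  move=> S; apply: (large_index_no_dual_word fM fR idx nK eK fe) => //.
  by rewrite card_power_index.
- by apply: (@block_case 4 4 _ (D_frame 4) (D_generators 4) f fM fR);
    vm_compute.
- by apply: (@block_case 2 8 _ (D_frame 8) (D_generators 8) f fM fR);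
    vm_compute.
- apply: (thin_case _ (list_frame _ (D_frame 16))).
  + by apply: list_frameP; [|vm_compute].
  + by rewrite card_ord.
  + by apply: (thin_checkP (V := D_generators 16)); vm_compute.
by apply: (@block_case 2 8 _ E8_frame (mkseq (unit_list 8) 8) f fM fR);
    vm_compute.
Qed.

(** * Roots outside the saturation *)

Lemma isometry_negative_definite (K N : lattice) (f : {linear K -> N}) :
  embedding f -> negative_definite N -> negative_definite K.
Proof.
move=> [inj iso] nN v v0; rewrite -iso; apply: nN.
by apply: contra v0 => /eqP fv; apply/eqP/inj; rewrite fv raddf0.
Qed.

Section Saturation.
Import VectorInternalTheory.

Lemma saturation_half (N : lattice) (M : set N) x r :
  M x -> r *+ 2 = x -> saturation M r.
Proof.
move=> Mx rx; exists 1%N, (fun=> 2^-1), (fun=> tensorQ x); split=> [_|].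
  by exists x.
rewrite big_ord1 -rx mulr2n /tensorQ raddfD; apply/rowP=> i; rewrite !mxE.
by rewrite rmorphD /=; move: (intr _) => z; field.
Qed.
End Saturation.

Lemma odd_absz_sum (J : finType) (F : J -> int) :
  odd (absz (\sum_j F j)) = odd #|[set j | odd `|F j|%N]%SET|.
Proof.
rewrite -sum1_card [in RHS]big_mkcond /=.
rewrite (big_morph (fun z : int => odd (absz z)) odd_abszD (_ : _ = false)) //.
rewrite (big_morph odd oddD (_ : _ = false)) //.
by apply: eq_bigr => j _; rewrite inE; case: ifP.
Qed.

Section Roots.
Variables (K N : lattice) (f : {linear K -> N}) (J : finType) (e : J -> K).
Hypotheses (nN : negative_definite N) (fE : embedding f) (fe : frame e).

(** The form takes the value 2 (sum_j c_j^2) - 8 on 2r + sum_j c_j e_j, for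
    c_j = r.e_j; if this vector is 0 then r is half an element of the image. *)
Lemma root_saturation_or_small r : '[r] = -2 -> ~ saturation (range f) r ->
  \sum_j '[f (e j), r] ^+ 2 <= 3.
Proof.
move=> rr NSr; set c := \sum_j _; pose u := \sum_j '[f (e j), r] *: e j.
have fur : '[f u, r] = c.
  rewrite raddf_sum lat_form_suml /=; apply: eq_bigr => j _.
  by rewrite linearZ lat_formZl -expr2.
have fuu : '[f u] = -2 * c.
  have ue j : '[u, e j] = -2 * '[f (e j), r] := frame_coord fe _ j.
  rewrite fE.2 {1}/u lat_form_suml mulr_sumr; apply: eq_bigr => j _.
  by rewrite lat_formZl (lat_formC (e j)) ue expr2; ring.
have v0 : r *+ 2 + f u != 0.
  apply/eqP=> v0; apply: NSr; apply: (@saturation_half _ _ (f (- u))).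
    by exists (- u).
  by rewrite raddfN; apply/eqP; rewrite -addr_eq0 v0.
have := nN v0; rewrite lat_formDl lat_formMnl (lat_formC r) (lat_formC (f u)).
rewrite !lat_formDl fur (lat_formC r) fur fuu rr; lia.
Qed.

(** Twice the product of r and x is minus the sum of the products
    '[x, e_j] '[e_j, r]. *)
Lemma odd_pairings_dual r :
  dual_word e [set j | odd `|'[f (e j), r]|%N]%SET.
Proof.
move=> x; apply/negP => oddx.
have : '[f x, r] *+ 2 = - \sum_j '[x, e j] * '[f (e j), r].
  rewrite -lat_formMnl -raddfMn (frame_full fe) raddfN lat_formNl raddf_sum.
  rewrite lat_form_suml /=; congr (- _); apply: eq_bigr => j _.
  by rewrite linearZ lat_formZl.
move=> /(congr1 (fun z : int => odd (absz z))); rewrite /= abszN odd_absz_sum.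
suff -> : [set j | odd (absz ('[x, e j] * '[f (e j), r]))]%SET =
    [set j in [set j | odd `|'[f (e j), r]|%N] | parity e x j]%SET.
  by rewrite oddx; lia.
by apply/finset.setP=> j; rewrite !inE abszM oddM ffunE andbC.
Qed.
End Roots.

Theorem proposition3p11 (K N : lattice) (iota : {linear K -> N})
    (hK : kummer_lattice K) (hNeg : negative_definite N)
    (hEven : even_lattice N) (hiota : embedding iota) :
  orthogonal_sets (range iota)
    (roots_of [set: N] `\` roots_of (saturation (range iota))) /\
  (saturated_embedding iota ->
   orthogonal_sets (roots_of (range iota))
     (roots_of [set: N] `\` roots_of (range iota))).
Proof.
suff orth : orthogonal_sets (range iota)
    (roots_of [set: N] `\` roots_of (saturation (range iota))).
  split=> // -[_ sat]; rewrite -sat in orth.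
  by move=> u v [ru _]; apply: orth.
have [t tK] := hK; have nK := isometry_negative_definite hiota hNeg.
have [J [e [fe dual]]] := kummer_no_dual_word nK tK.
move=> _ r [x _ <-] [[_ rr] Nr].
have small : \sum_j '[iota (e j), r] ^+ 2 <= 3.
  by apply: (root_saturation_or_small hNeg hiota fe rr) => Sr; apply: Nr.
set S := [set j | odd `|'[iota (e j), r]|%N]%SET.
have S3 : (#|S| <= 3)%N.
  rewrite -(ler_nat int) -sum1_card natr_sum; apply: le_trans small.
  rewrite big_mkcond; apply: ler_sum => j _; rewrite inE.
  by case: ifP => [o|_]; rewrite ?sqr_ge0 //; nia.
have S0 : #|S| = 0%N.
  apply/eqP; rewrite -leqn0 leqNgt; apply/negP => S0.
  by apply: (dual S); [rewrite S0 | apply: odd_pairings_dual].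
have er j : '[iota (e j), r] = 0.
  have : j \notin S by rewrite (finset.cards0_eq S0) inE.
  rewrite inE => even.
  have : '[iota (e j), r] ^+ 2 <= 3.
    apply: le_trans small; rewrite (bigD1 j) //= lerDl sumr_ge0 // => i _.
    exact: sqr_ge0.
  by move: ('[_, _]) even => z even; nia.
have : '[iota x, r] *+ 2 = 0.
  rewrite -lat_formMnl -raddfMn (frame_full fe) raddfN raddf_sum /=.
  rewrite lat_formNl lat_form_suml big1 ?oppr0 // => j _.
  by rewrite linearZ lat_formZl er mulr0.
by move/eqP; rewrite mulrn_eq0 /= => /eqP.
Qed.
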